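(* Let $\mathbb F$ be a field, let $N\in\mathbb N$, let $V$ be a vector space over $\mathbb F$ of dimension $N+1$, and let $B$ be a Billiard Array on $V$. Then the $B$-flags $[1],[2],[3]$ on $V$ are totally opposite.
   Context: $\mathbb N=\{0,1,2,\ldots\}$. $\Delta_N=\{(r,s,t): r,s,t\in\mathbb N,\ r+s+t=N\}$, whose elements are called locations. A line in $\Delta_N$ is a set consisting of all locations whose $\eta$-coordinate equals a fixed number $n$, for some $\eta\in\{1,2,3\}$ and some $0\le n\le N$. For $N\ge1$, a black 3-clique in $\Delta_N$ is a set $\{(r+1,s,t),(r,s+1,t),(r,s,t+1)\}$ with $(r,s,t)\in\Delta_{N-1}$ (there are none for $N=0$). Let $\mathcal P_1(V)$ be the set of one-dimensional subspaces of $V$. A Billiard Array on $V$ (where $\dim V=N+1$) is a function $B:\Delta_N\to\mathcal P_1(V)$, $\lambda\mapsto B_\lambda$, such that (i) for each line $L$ in $\Delta_N$ the sum $\sum_{\lambda\in L}B_\lambda$ is direct; (ii) for each black 3-clique $C$ in $\Delta_N$ the sum $\sum_{\lambda\in C}B_\lambda$ is not direct. A flag on $V$ is a sequence $\{U_i\}_{i=0}^N$ of subspaces of $V$ with $\dim U_i=i+1$ for $0\le i\le N$ and $U_{i-1}\subseteq U_i$ for $1\le i\le N$. For $\eta\in\{1,2,3\}$ the $B$-flag $[\eta]$ is the sequence $\{U_i\}_{i=0}^N$, where $U_i$ is the sum of all $B_\lambda$ over the $\lambda\in\Delta_N$ with $\eta$-coordinate at least $N-i$; it is a flag on $V$. Three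 flags $\{U_i\}_{i=0}^N,\{U'_i\}_{i=0}^N,\{U''_i\}_{i=0}^N$ on $V$ are called totally opposite whenever $U_{N-r}\cap U'_{N-s}\cap U''_{N-t}=0$ for all integers $r,s,t$ with $0\le r,s,t\le N$ and $r+s+t>N$. *)

(* Defs.v *)
From HB Require Import structures.
From mathcomp Require Import all_boot all_order all_algebra.

Set Implicit Arguments.
Unset Strict Implicit.
Unset Printing Implicit Defensive.

Import GRing.Theory.

(* The coordinates of a location are at most N because they sum to N, so taking
   them in 'I_N.+1 loses nothing and makes Delta_N a finType. *)
Record location (N : nat) : Type := Location {
  loc_val : 3.-tuple 'I_N.+1;
  loc_valP : \sum_(eta < 3) tnth loc_val eta == N
}.

HB.instance Definition _ (N : nat) := [isSub for @loc_val N].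
HB.instance Definition _ (N : nat) := [Finite of location N by <:].

(* eta = 0, 1, 2 stand for the first, second and third coordinates. *)
Definition coord (N : nat) (l : location N) (eta : 'I_3) : nat :=
  tnth (loc_val l) eta.

Definition coords (N : nat) (l : location N) : seq nat :=
  [seq coord l eta | eta <- enum 'I_3].

Definition is_line (N : nat) (L : {set location N}) : Prop :=
  exists (eta : 'I_3) (n : nat),
    n <= N /\ L = [set l | coord l eta == n].

Definition is_black_3clique (N : nat) (C : {set location N}) : Prop :=
  exists r s t : nat,
    (r + s + t).+1 = N /\
    C = [set l | coords l \in
           [:: [:: r.+1; s; t]; [:: r; s.+1; t]; [:: r; s; t.+1]]].

Record billiard_array (F : fieldType) (V : vectType F) (N : nat)
    (B : location N -> {vspace V}) : Prop := BilliardArray {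
  ba_dim : forall l : location N, \dim (B l) = 1;
  ba_line : forall L : {set location N},
    is_line L -> directv (\sum_(l in L) B l)%VS;
  ba_clique : forall C : {set location N},
    is_black_3clique C -> ~~ directv (\sum_(l in C) B l)%VS
}.

Definition is_flag (F : fieldType) (V : vectType F) (N : nat)
    (U : 'I_N.+1 -> {vspace V}) : Prop :=
  (forall i : 'I_N.+1, \dim (U i) = i.+1) /\
  (forall i j : 'I_N.+1, j = i.+1 :> nat -> (U i <= U j)%VS).

Definition B_flag (F : fieldType) (V : vectType F) (N : nat)
    (B : location N -> {vspace V}) (eta : 'I_3) (i : 'I_N.+1) : {vspace V} :=
  (\sum_(l : location N | (N - i <= coord l eta)%N) B l)%VS.

(* Being flags is part of the notion. [sub_ord r] has value N - r. *)
Definition totally_opposite (F : fieldType) (V : vectType F) (N : nat)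
    (U U' U'' : 'I_N.+1 -> {vspace V}) : Prop :=
  [/\ is_flag U, is_flag U', is_flag U'' &
    forall r s t : 'I_N.+1, N < r + s + t ->
      (U (sub_ord r) :&: U' (sub_ord s) :&: U'' (sub_ord t))%VS = 0%VS].

(* Main.v *)
Require Import Defs.
From HB Require Import structures.
From mathcomp Require Import all_boot all_order all_algebra.
From mathcomp Require Import zify.
(* Imported again last, for its [coord] to prevail over the one for bases. *)
Import Defs.

Set Implicit Arguments.
Unset Strict Implicit.
Unset Printing Implicit Defensive.

(** For lower bounds [m] on the three coordinates, let [cone B m] be the span of
    the [B l] with [l] at or above [m] in every coordinate; these locations form
    a smaller triangle, cut out of Delta_N.

    Any two locations of a black 3-clique lie on a common line, so their lines
    in V are independent and the third one lies in the sum of these.  Pushing a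
    location step by step towards a side of a triangle, this shows that a cone
    is already spanned by the locations on any one side of its triangle
    ([cone_side]).  Those locations lie on one line of Delta_N, where the sum is
    direct.

    The B-flags consist of the cones that bound a single coordinate, so
    counting the locations on a side gives their dimensions.  Moreover, two
    cones whose triangles have their sides on a common line are spanned by parts
    of one direct sum, so they meet in the cone of the intersection of the
    triangles ([cone_cap]).  Bounding the coordinates by r, s, t, this gives in
    turn
      (r,0,0) & (0,s,0) = (r,s,0),  (r,0,0) & (0,0,t) = (r,0,t),
      (r,s,0) & (r,0,t) = (r,s,t),
    and no location lies above (r,s,t) when r + s + t > N. *)

(** * Direct sums of subspaces *)

Section DirectSums.

Variables (F : fieldType) (V : vectType F) (I : finType) (B : I -> {vspace V}).

(** Both decompositions of a common vector extend by zero to the whole family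
    [L], where they must agree. *)
Lemma directv_sum_cap (L P Q : {pred I}) :
    directv (\sum_(i in L) B i)%VS -> {subset P <= L} -> {subset Q <= L} ->
  ((\sum_(i in P) B i) :&: (\sum_(i in Q) B i) <=
     \sum_(i | (i \in P) && (i \in Q)) B i)%VS.
Proof.
move=> dL sPL sQL; apply/subvP => v; rewrite memv_cap => /andP[].
move=> /memv_sumP[u Pu Dv] /memv_sumP[w Qw Dv'].
pose u' i := if i \in P then u i else 0%R.
pose w' i := if i \in Q then w i else 0%R.
have ext (R : {pred I}) (z : I -> V) : {subset R <= L} ->
    (\sum_(i in R) z i = \sum_(i in L) if i \in R then z i else 0)%R.
  move=> sRL; rewrite -big_mkcondr; apply: eq_bigl => i.
  by case Ri: (i \in R); rewrite ?andbT ?andbF // sRL.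
have Bu i : i \in L -> u' i \in B i.
  by rewrite /u' => _; case: ifP => [/Pu | _] //; apply: mem0v.
have Bw i : i \in L -> w' i \in B i.
  by rewrite /w' => _; case: ifP => [/Qw | _] //; apply: mem0v.
have := directv_sum_unique dL _ _ Bu Bw.
rewrite /u' /w' -!ext // -Dv -Dv' eqxx => /esym/forall_inP eq_uw.
rewrite Dv big_mkcond; apply: memv_suml => i _.
case Pi: (i \in P); last exact: mem0v.
have := eq_uw i (sPL i Pi); rewrite Pi.
case Qi: (i \in Q) => /eqP ui; last by rewrite ui mem0v.
by apply: (subvP (sumv_sup i _ (subvv _))); rewrite ?Pi ?Qi ?Pu.
Qed.

Hypothesis dimB : forall i, \dim (B i) = 1.

Lemma dim_directv_sub (L P : {pred I}) :
    directv (\sum_(i in L) B i)%VS -> {subset P <= L} ->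
  \dim (\sum_(i in P) B i)%VS = #|P|.
Proof.
move=> dL sPL; rewrite -sum1_card -(eq_bigr _ (fun i _ => dimB i)).
apply/eqP; rewrite -directvE /=; apply/directv_sumP => i Pi.
apply/eqP; rewrite -subv0.
rewrite -[X in (_ <= X)%VS](directv_sumP dL i (sPL i Pi)) capvS //.
apply/subv_sumP => j /andP[Pj ji]; apply: (sumv_sup j) => //.
by rewrite sPL.
Qed.

(** Adding [B i] to the direct sum over [C :\ i] cannot raise the dimension,
    as the sum over [C] would then be direct. *)
Lemma ndirectv_sub (L : {pred I}) (C : {set I}) (i : I) :
    directv (\sum_(j in L) B j)%VS -> ~~ directv (\sum_(j in C) B j)%VS ->
    i \in C -> {subset C :\ i <= L} ->
  (B i <= \sum_(j in C :\ i) B j)%VS.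
Proof.
move=> dL ndC Ci sCL.
have le_sum : (\sum_(j in C :\ i) B j <= \sum_(j in C) B j)%VS.
  by apply/subv_sumP => j /setD1P[_ Cj]; apply: (sumv_sup j).
have lt_dim : \dim (\sum_(j in C) B j)%VS < #|C|.
  rewrite -sum1_card -(eq_bigr _ (fun j _ => dimB j)) ltn_neqAle.
  by rewrite -directvE ndC /= dimv_leq_sum.
have /eqP-> : (\sum_(j in C :\ i) B j == \sum_(j in C) B j)%VS.
  rewrite eqEdim le_sum (dim_directv_sub dL sCL).
  by move: lt_dim; rewrite (cardsD1 i C) Ci.
exact: (sumv_sup i).
Qed.

End DirectSums.

(** * Locations, lines and black cliques *)

Section Locations.

Variable N : nat.
Implicit Types (l : location N) (j eta : 'I_3).

Lemma forall_I3 (P : 'I_3 -> Prop) :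
  (forall j, P j) <-> [/\ P ord0, P (inord 1) & P (inord 2)].
Proof.
split=> [allP | [P0 P1 P2] j]; first by split.
have [->|[->|->]] // : j = ord0 \/ j = inord 1 \/ j = inord 2.
case: j => [[|[|[|//]]] i]; [left | right; left | right; right];
  by apply: val_inj; rewrite /= ?inordK.
Qed.

Lemma big_I3 (f : 'I_3 -> nat) :
  \sum_j f j = f ord0 + f (inord 1) + f (inord 2).
Proof.
rewrite !big_ord_recl big_ord0 addn0 addnA.
by congr (f _ + f _ + f _); apply: val_inj; rewrite /= inordK.
Qed.

Lemma big_I3_ordS (f : 'I_3 -> nat) eta :
  \sum_j f j = f eta + f (ordS eta) + f (ordS (ordS eta)).
Proof.
rewrite (bigD1 eta) //= (bigD1 (ordS eta)) /=; last first.
  by case: eta => [[|[|[|//]]] i].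
rewrite (bigD1 (ordS (ordS eta))) /=; last first.
  by case: eta => [[|[|[|//]]] i].
rewrite big1 ?addn0 ?addnA // => j; move: eta j.
by do 2!case=> [[|[|[|//]]] ?].
Qed.

Lemma sum_coord l : \sum_j coord l j = N.
Proof. exact/eqP/(loc_valP l). Qed.

Lemma coord_leq l j : coord l j <= N.
Proof. by rewrite -ltnS ltn_ord. Qed.

Lemma coord_inj l l' : coord l =1 coord l' -> l = l'.
Proof.
by move=> eq_l; apply/val_inj/eq_from_tnth => j; apply/val_inj/eq_l.
Qed.

Lemma location_of (f : 'I_3 -> nat) :
  \sum_j f j = N -> {l : location N | coord l =1 f}.
Proof.
move=> sumf; have ltf j : f j < N.+1 by rewrite ltnS -sumf (bigD1 j) ?leq_addr.
have lP : \sum_(j < 3) tnth [tuple Ordinal (ltf i) | i < 3] j == N.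
  by apply/eqP; rewrite -[RHS]sumf; apply: eq_bigr => j _; rewrite tnth_mktuple.
by exists (Location lP) => j; rewrite /coord tnth_mktuple.
Qed.

Lemma coordsE l :
  coords l = [:: coord l ord0; coord l (inord 1); coord l (inord 2)].
Proof.
rewrite /coords !enum_ordSl enum_ord0 /=.
by congr [:: _; coord l _; coord l _]; apply: val_inj; rewrite /= inordK.
Qed.

(** On a line, a location is determined by either of the two other coordinates;
    this is the cyclically next one here, and it is free in [0, N - n]. *)
Lemma card_line eta n : n <= N ->
  #|[set l : location N | coord l eta == n]| = (N - n).+1.
Proof.
move=> le_nN; pose th := ordS eta.
pose f (k : 'I_(N - n).+1) j :=
  if j == eta then n else if j == th then val k else N - n - k.
have sumf k : \sum_j f k j = N.
  have := ltn_ord k; rewrite ltnS /f /th => le_k.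
  rewrite big_I3; case: (eta) => [[|[|[|//]]] i];
    rewrite -!val_eqE /= ?inordK //=; lia.
pose g k := sval (location_of (sumf k)).
have gE k : coord (g k) =1 f k := svalP (location_of (sumf k)).
have th_eta : (th == eta) = false.
  by rewrite /th; case: (eta) => [[|[|[|//]]] i].
have g_inj : injective g.
  move=> k k' eq_g; apply: val_inj.
  by have := gE k' th; rewrite -eq_g gE /f th_eta eqxx.
rewrite -[RHS]card_ord -(card_imset _ g_inj); apply: eq_card => l.
rewrite inE; apply/eqP/imsetP => [l_eta | [k _ ->]]; last by rewrite gE /f eqxx.
have := sum_coord l; rewrite (big_I3_ordS _ eta) l_eta -/th => suml.
have lt_k : coord l th < (N - n).+1 by lia.
exists (Ordinal lt_k) => //; apply: coord_inj => j; rewrite gE /f /=.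
have [->//|j_eta] := eqVneq j eta; have [->//|j_th] := eqVneq j th.
have -> : j = ordS th.
  move: j_eta j_th; rewrite /th; move: (j) (eta).
  by do 2!case=> [[|[|[|//]]] ?] //; rewrite -?val_eqE // => _ _;
    apply: val_inj.
lia.
Qed.

(** The clique is [l] together with the two locations obtained by moving one
    unit from the coordinate [eta] to another one. *)
Lemma black_3clique_at l eta : 0 < coord l eta ->
  exists C : {set location N}, [/\ is_black_3clique C, l \in C
    & forall l', l' \in C :\ l ->
        (coord l' eta).+1 = coord l eta
        /\ forall j, j != eta -> coord l j <= coord l' j].
Proof.
move=> l_eta; pose b j := coord l j - (j == eta).
have bK j : b j + (j == eta) = coord l j.
  by rewrite /b subnK //; case: (eqVneq j eta) => [-> |].
have sumb : (\sum_j b j).+1 = N.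
  rewrite -(sum_coord l) -(eq_bigr _ (fun j _ => bK j)) big_split /=.
  by rewrite -big_mkcond /= big_pred1_eq addn1.
pose C := [set x : location N |
  [exists th, [forall j, coord x j == b j + (j == th)]]].
exists C; split.
- exists (b ord0), (b (inord 1)), (b (inord 2)); split.
    by rewrite -big_I3.
  apply/setP => x; rewrite !inE coordsE !eqseq_cons !andbT.
  apply/existsP/or3P => [[] | xC].
    apply/forall_I3; split=> /forallP xP;
      [constructor 1 | constructor 2 | constructor 3];
      by rewrite !(eqP (xP _)) -!val_eqE /= ?inordK // !addn0 ?addn1 !eqxx.
  case: xC => /and3P[/eqP x0 /eqP x1 /eqP x2];
    [exists ord0 | exists (inord 1) | exists (inord 2)]; apply/forallP;
    by apply/forall_I3; split;
      rewrite ?(x0, x1, x2) -val_eqE /= ?inordK // ?addn1 ?addn0.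
- rewrite inE; apply/existsP; exists eta; apply/forallP => j.
  by rewrite bK.
move=> l' /setD1P[l'l]; rewrite inE => /existsP[th /forallP/= l'P].
have th_eta : th != eta.
  apply: contraNneq l'l => th_eta; apply/eqP/coord_inj => j.
  by rewrite (eqP (l'P j)) th_eta bK.
split=> [|j j_eta]; rewrite (eqP (l'P _)) /b.
  by rewrite eqxx eq_sym (negPf th_eta) addn0 subn1 prednK.
by rewrite (negPf j_eta) subn0 leq_addr.
Qed.

End Locations.

(** * Cones *)

Section Cones.

Variables (F : fieldType) (V : vectType F) (N : nat).
Variables (B : location N -> {vspace V}) (hB : billiard_array B).
Implicit Types (l : location N) (eta : 'I_3) (m : 'I_3 -> nat).

Definition above m l := [forall j, m j <= coord l j].

Definition cone m : {vspace V} := (\sum_(l | above m l) B l)%VS.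

(** Bounds a single coordinate, as in the definition of the B-flags. *)
Definition bound eta r : 'I_3 -> nat := fun j => if j == eta then r else 0.

Lemma directv_line eta n : n <= N ->
  directv (\sum_(l in [set l : location N | coord l eta == n]) B l)%VS.
Proof. by move=> le_nN; apply: (ba_line hB); exists eta, n. Qed.

(** The clique at [l] has its other two locations on a common line, one step
    closer to the side, and still above [m]. *)
Lemma cone_side m eta :
  (cone m <= \sum_(l | above m l && (coord l eta == m eta)) B l)%VS.
Proof.
apply/subv_sumP => l; have [k le_k] := ubnP (coord l eta).
elim: k l le_k => // k IHk l le_k lm.
have m_eta := forallP lm eta.
have [l_eta | l_eta] := eqVneq (coord l eta) (m eta).
  by apply: (sumv_sup l); rewrite ?lm ?l_eta /=.
have l_gt0 : 0 < coord l eta by lia.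
have [C [cliqueC Cl CP]] := black_3clique_at l_gt0.
have le_N : (coord l eta).-1 <= N.
  exact: leq_trans (leq_pred _) (coord_leq l eta).
have sCL : {subset C :\ l <= [set l' | coord l' eta == (coord l eta).-1]}.
  by move=> l' /CP[<- _]; rewrite inE.
apply: subv_trans (ndirectv_sub (ba_dim hB) (directv_line eta le_N)
  (ba_clique hB cliqueC) Cl sCL) _.
apply/subv_sumP => l' /CP[l'_eta le_l']; apply: IHk; first by lia.
apply/forallP => j; have [-> | j_eta] := eqVneq j eta; first by lia.
exact: leq_trans (forallP lm j) (le_l' j j_eta).
Qed.

(** Both cones are spanned by parts of the direct sum over their common side. *)
Lemma cone_cap m m' eta : m eta = m' eta -> m eta <= N ->
  (cone m :&: cone m' <= cone (fun j => maxn (m j) (m' j)))%VS.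
Proof.
move=> eq_m le_N.
apply: subv_trans (capvS (cone_side m eta) (cone_side m' eta)) _.
apply: subv_trans (directv_sum_cap (directv_line eta le_N)
  (P := [pred l | above m l && (coord l eta == m eta)])
  (Q := [pred l | above m' l && (coord l eta == m' eta)]) _ _) _.
- by move=> l; rewrite !inE => /andP[].
- by move=> l; rewrite !inE eq_m => /andP[].
apply/subv_sumP => l; rewrite !inE => /andP[/andP[lm _] /andP[lm' _]].
apply: (sumv_sup l) => //; apply/forallP => j.
by rewrite geq_max (forallP lm) (forallP lm').
Qed.

Lemma above_bound eta r l : above (bound eta r) l = (r <= coord l eta).
Proof.
apply/forallP/idP => [/(_ eta) | le_r j]; rewrite /bound ?eqxx //.
by case: eqP => [-> |].
Qed.

(** The cone is the direct sum over its side on the line [coord l eta = r]. *)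
Lemma dim_cone_bound eta r : r <= N -> \dim (cone (bound eta r)) = (N - r).+1.
Proof.
move=> le_rN; rewrite -(card_line eta le_rN).
rewrite -(dim_directv_sub (ba_dim hB) (directv_line eta le_rN)) //.
congr (\dim _); apply/eqP; rewrite eqEsubv; apply/andP; split.
  apply: subv_trans (cone_side _ eta) _; apply/subv_sumP => l /andP[_ l_eta].
  by apply: (sumv_sup l); rewrite // inE (eqP l_eta) /bound eqxx.
apply/subv_sumP => l; rewrite inE => /eqP l_eta.
by apply: (sumv_sup l); rewrite // above_bound l_eta.
Qed.

Lemma cone_eq0 m : N < \sum_j m j -> cone m = 0%VS.
Proof.
move=> lt_N; rewrite /cone big_pred0 // => l.
apply/negP => /forallP lm; move: lt_N; rewrite ltnNge => /negP[].
by rewrite -[leqRHS](sum_coord l) leq_sum.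
Qed.

Lemma B_flagE eta (i : 'I_N.+1) : B_flag B eta i = cone (bound eta (N - i)).
Proof. by apply: eq_bigl => l; rewrite above_bound. Qed.

Lemma is_flag_B_flag eta : is_flag (B_flag B eta).
Proof.
split=> [i | i j ij].
  by rewrite B_flagE dim_cone_bound ?leq_subr // subKn // -ltnS.
apply/subv_sumP => l le_l; apply: (sumv_sup l) => //.
by rewrite (leq_trans _ le_l) // ij leq_sub2l.
Qed.

End Cones.

Theorem theorem12p4 (F : fieldType) (N : nat) (V : vectType F)
    (dimV : \dim {:V} = N.+1) (B : location N -> {vspace V})
    (hB : billiard_array B) :
  totally_opposite
    (B_flag B (@Ordinal 3 0 isT)) (B_flag B (@Ordinal 3 1 isT))
    (B_flag B (@Ordinal 3 2 isT)).
Proof.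
split; try exact: is_flag_B_flag.
move=> r s t lt_N; rewrite !B_flagE /= !subKn ?leq_ord //.
set X := bound _ r; set Y := bound _ s; set Z := bound _ t.
have le_rN := leq_ord r.
apply/eqP; rewrite -subv0.
pose XY j := maxn (X j) (Y j); pose XZ j := maxn (X j) (Z j).
(* [X] and [Y] agree, with value 0, on the third coordinate; [X] and [Z] on the
   second one; [XY] and [XZ], with value [r], on the first one. *)
have XY_le : (cone B X :&: cone B Y <= cone B XY)%VS.
  exact: (cone_cap hB (eta := @Ordinal 3 2 isT)).
have XZ_le : (cone B X :&: cone B Z <= cone B XZ)%VS.
  exact: (cone_cap hB (eta := @Ordinal 3 1 isT)).
have <- : cone B (fun j => maxn (XY j) (XZ j)) = 0%VS.
  apply: cone_eq0; rewrite !big_ord_recl big_ord0.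
  by rewrite /XY /XZ /X /Y /Z /bound /=; lia.
apply: subv_trans (cone_cap hB (eta := @Ordinal 3 0 isT) _ _); last 2 first.
- by rewrite /XY /XZ /Y /Z /bound.
- by rewrite /XY /X /Y /bound /= maxn0.
rewrite subv_cap; apply/andP; split.
  by apply: subv_trans XY_le; rewrite capvSl.
by apply: subv_trans XZ_le; rewrite capvS // capvSl.
Qed.
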